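(* Let $M=(\Sigma,A_{S_0},T_R)$ be a regular system, $\mathit{COP}=\{cop_1,\dots,cop_k\}$ a set of state properties, $gsp$ a global system property over $\mathit{COP}$, and let $M^a_{\neg gsp}=(\Sigma^a,A^a_{S_0},T^a_R,F^a)$ be the Büchi regular system constructed from them as described in the context. Then: (a) for every accepting execution $\pi^a=\pi^a(0)\pi^a(1)\cdots$ of $M^a_{\neg gsp}$, the sequence $\pi=w_0w_1w_2\cdots$ with $w_i=\Pi_\Sigma(\pi^a(i))$ for all $i$ is an execution of $M$ that does not satisfy $gsp$; and (b) for every execution $\pi=w_0w_1\cdots$ of $M$ that does not satisfy $gsp$, there is an accepting execution $\pi^a$ of $M^a_{\neg gsp}$ with $\Pi_\Sigma(\pi^a(i))=w_i$ for all $i$.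
   Context: A regular system $M=(\Sigma,A_{S_0},T_R)$ consists of a finite alphabet $\Sigma$, a deterministic finite-word automaton $A_{S_0}$ over $\Sigma$ (the initial states are the words of $L(A_{S_0})$) and a deterministic finite-word transducer $T_R=(Q_R,\Sigma\times\Sigma,q_{0R},\delta_R,F_R)$, i.e. a finite automaton over the alphabet $\Sigma\times\Sigma$; it represents the relation $R$ of pairs $(u,v)$ of words of equal length $n$ such that the word $(u(0),v(0))\cdots(u(n-1),v(n-1))$ is accepted. States of $M$ are finite words over $\Sigma$; an execution of $M$ is an infinite sequence $w_0w_1\cdots$ with $w_0\in L(A_{S_0})$ and $(w_i,w_{i+1})\in R$ for all $i$ (all executions are assumed infinite). A state property is a set $cop\subseteq\Sigma^*$; each $cop_i$ is recognized by a complete deterministic finite-word automaton $A_{cop_i}=(Q_{cop_i},\Sigma,q_{0,cop_i},\delta_{cop_i},F_{cop_i})$. For $w\in\Sigma^*$, $\mathbf{cop}(w)=\{cop_i\in\mathit{COP}\mid w\in cop_i\}$. A global system property is a set $gsp\subseteq(2^{\mathit{COP}})^\omega$ recognized by a Büchi automaton; an execution $w_0w_1\cdots$ satisfies $gsp$ iff $\mathbf{cop}(w_0)\mathbf{cop}(w_1)\cdots\in gsp$. Let $A_{\neg gsp}=(Q_{\neg gsp},2^{\mathit{COP}},q_{0,\neg gsp},\Delta_{\neg gsp},F_{\neg gsp})$ be a complete Büchi automaton recognizing $(2^{\mathit{COP}})^\omega\setminus gsp$. Construction of $M^a_{\neg gsp}$. Let $\Sigma^a=\Sigma\times(Q_{\neg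 gsp}\cup\{\bot\})\times(2^{\mathit{COP}}\cup\{\bot\})$, and for $w^a\in(\Sigma^a)^*$ let $\Pi_\Sigma(w^a)\in\Sigma^*$ be its letterwise projection onto the first component. The transducer $T^a_R$ over $\Sigma^a\times\Sigma^a$ has states $Q_R\times\prod_{i=1}^k Q_{cop_i}\times\{0,1\}$, initial state $(q_{0R},q_{0,cop_1},\dots,q_{0,cop_k},0)$, accepting states $F_R\times\prod_{i}Q_{cop_i}\times\{1\}$, and a transition from $(q_R,q_1,\dots,q_k,b)$ to $(q_R',q_1',\dots,q_k',b')$ on the letter pair $((a_1,\alpha_1,\lambda_1),(a_2,\alpha_2,\lambda_2))$ iff $q_R'\in\delta_R(q_R,(a_1,a_2))$, $q_i'=\delta_{cop_i}(q_i,a_1)$ for $1\le i\le k$, and $b'=1$ exactly when $\alpha_1,\lambda_1,\alpha_2,\lambda_2$ are all different from $\bot$, $\alpha_2\in\Delta_{\neg gsp}(\alpha_1,\lambda_1)$, and for every $1\le i\le k$: $q_i'\in F_{cop_i}$ iff $cop_i\in\lambda_1$ (otherwise $b'=0$). Its relation $R^a$ is the set of equal-length pairs of words over $\Sigma^a$ it accepts. The initial states $L(A^a_{S_0})$ are the words $(w(0),\bot,\bot)\cdots(w(n-2),\bot,\bot)(w(n-1),q_{0,\neg gsp},\lambda)$ with $w(0)\cdots w(n-1)\in L(A_{S_0})$ and $\lambda\in 2^{\mathit{COP}}$. The accepting-state set is $L(F^a)=(\Sigma\times\{\bot\}\times\{\bot\})^*(\Sigma\times F_{\neg gsp}\times 2^{\mathit{COP}})$.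 An execution of the Büchi regular system $M^a_{\neg gsp}$ is an infinite sequence $w^a_0w^a_1\cdots$ of words over $\Sigma^a$ with $w^a_0\in L(A^a_{S_0})$ and $(w^a_i,w^a_{i+1})\in R^a$ for all $i$; it is accepting if $w^a_i\in L(F^a)$ for infinitely many $i$.
   Formalization: Part (b) is stated only for executions whose initial state is not the empty word: if the empty word is initial, (ε,ε) is in R and εεε… violates gsp, then (b) fails, since every initial word of the constructed system is nonempty. *)

(* Defs.v *)
From HB Require Import structures.
From mathcomp Require Import all_boot.

Set Implicit Arguments.
Unset Strict Implicit.
Unset Printing Implicit Defensive.

(* The same tuple serves as a finite-word automaton (accepts) and as a Buchi  *)
(* automaton (buchi_accepts).                                                 *)
Record automaton (A : finType) := Automaton {
  state : finType;
  start : state;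
  delta : state -> A -> {set state};
  final : {set state}
}.

(* Deterministic automata may be partial. *)
Definition deterministic (A : finType) (N : automaton A) : Prop :=
  forall (q : state N) (a : A), #|delta q a| <= 1.

Definition complete (A : finType) (N : automaton A) : Prop :=
  forall (q : state N) (a : A), delta q a != set0.

Fixpoint accepts_from (A : finType) (N : automaton A) (q : state N)
    (w : seq A) : bool :=
  if w is a :: w' then [exists q' in delta q a, accepts_from q' w']
  else q \in final N.

Definition accepts (A : finType) (N : automaton A) (w : seq A) : bool :=
  accepts_from (start N) w.

Definition infinitely_often (P : nat -> Prop) : Prop :=
  forall n, exists2 m, n <= m & P m.

Definition buchi_accepts (A : finType) (N : automaton A) (x : nat -> A) :
    Prop :=
  exists rho : nat -> state N,
    [/\ rho 0 = start N,
        forall i, rho i.+1 \in delta (rho i) (x i) &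
        infinitely_often (fun i => rho i \in final N)].

(* Complete deterministic finite-word automata: total transition function. *)
Record cdfa (A : finType) := Cdfa {
  cstate : finType;
  cstart : cstate;
  cdelta : cstate -> A -> cstate;
  cfinal : {set cstate}
}.

Definition caccepts (A : finType) (D : cdfa A) (w : seq A) : bool :=
  foldl (@cdelta A D) (cstart D) w \in cfinal D.

(* zip truncates, hence the explicit equal-length condition. *)
Definition transducer_rel (A : finType) (T : automaton (A * A)%type)
    (u v : seq A) : bool :=
  (size u == size v) && accepts T (zip u v).

Record regular_system (Sigma : finType) := RegularSystem {
  rs_init : automaton Sigma;
  rs_trans : automaton (Sigma * Sigma)%type;
  rs_init_det : deterministic rs_init;
  rs_trans_det : deterministic rs_trans
}.

Definition is_execution (A : finType) (S0 : seq A -> Prop)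
    (R : seq A -> seq A -> Prop) (pi : nat -> seq A) : Prop :=
  S0 (pi 0) /\ forall i, R (pi i) (pi i.+1).

Definition execution (Sigma : finType) (M : regular_system Sigma)
    (pi : nat -> seq Sigma) : Prop :=
  is_execution (accepts (rs_init M)) (transducer_rel (rs_trans M)) pi.

(* COP = {cop_1, ..., cop_k} is an indexed family, and a subset of COP is     *)
(* represented by its set of indices.                                         *)
Definition cop_of (Sigma : finType) (k : nat) (cop : 'I_k -> pred (seq Sigma))
    (w : seq Sigma) : {set 'I_k} :=
  [set i | cop i w].

Definition satisfies (Sigma : finType) (k : nat)
    (cop : 'I_k -> pred (seq Sigma)) (gsp : (nat -> {set 'I_k}) -> Prop)
    (pi : nat -> seq Sigma) : Prop :=
  gsp (fun i => cop_of cop (pi i)).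

Section Augmented.

Variables (Sigma : finType) (M : regular_system Sigma) (k : nat).
Variables (Acop : 'I_k -> cdfa Sigma) (Angsp : automaton {set 'I_k}).

(* None plays the role of the symbol bot in the last two components. *)
Definition aug_alphabet : finType :=
  (Sigma * option (state Angsp) * option {set 'I_k})%type.

Definition proj_Sigma (wa : seq aug_alphabet) : seq Sigma :=
  [seq x.1.1 | x <- wa].

Definition aug_state : finType :=
  (state (rs_trans M) * {dffun forall i : 'I_k, cstate (Acop i)} * bool)%type.

Definition aug_start : aug_state :=
  (start (rs_trans M),
   [ffun i : 'I_k => cstart (Acop i)] : {dffun forall i, cstate (Acop i)},
   false).

(* The value of the bit b' reached by a transition on the letter pair (x, y)  *)
(* whose new cop-components are qc'.                                          *)
Definition aug_bit (x y : aug_alphabet)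
    (qc' : {dffun forall i : 'I_k, cstate (Acop i)}) : bool :=
  match x, y with
  | (_, Some al1, Some la1), (_, Some al2, Some _) =>
      (al2 \in delta al1 la1)
      && [forall i, (qc' i \in cfinal (Acop i)) == (i \in la1)]
  | _, _ => false
  end.

Definition aug_delta (q : aug_state) (xy : aug_alphabet * aug_alphabet) :
    {set aug_state} :=
  let: (qR, qc, _) := q in
  let: (x, y) := xy in
  [set q' : aug_state |
    let: (qR', qc', b') := q' in
    [&& qR' \in delta qR (x.1.1, y.1.1),
        [forall i, qc' i == cdelta (qc i) x.1.1]
      & b' == aug_bit x y qc']].

Definition aug_final : {set aug_state} :=
  [set q : aug_state | (q.1.1 \in final (rs_trans M)) && q.2].

Definition aug_transducer : automaton (aug_alphabet * aug_alphabet)%type :=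
  Automaton aug_start aug_delta aug_final.

(* The words (w(0),bot,bot) ... (w(n-2),bot,bot) (w(n-1),al,la), where        *)
(* w(0) ... w(n-1) is rcons w a; they are nonempty.                           *)
Definition aug_word (w : seq Sigma) (a : Sigma) (al : state Angsp)
    (la : {set 'I_k}) : seq aug_alphabet :=
  rcons [seq (x, None, None) | x <- w] (a, Some al, Some la).

Definition aug_init (wa : seq aug_alphabet) : Prop :=
  exists (w : seq Sigma) (a : Sigma) (la : {set 'I_k}),
    accepts (rs_init M) (rcons w a) /\ wa = aug_word w a (start Angsp) la.

Definition aug_accepting (wa : seq aug_alphabet) : Prop :=
  exists (w : seq Sigma) (a : Sigma) (al : state Angsp) (la : {set 'I_k}),
    al \in final Angsp /\ wa = aug_word w a al la.

Definition aug_execution (pia : nat -> seq aug_alphabet) : Prop :=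
  is_execution aug_init (transducer_rel aug_transducer) pia.

Definition aug_accepting_execution (pia : nat -> seq aug_alphabet) : Prop :=
  aug_execution pia /\ infinitely_often (fun i => aug_accepting (pia i)).

End Augmented.

(* Main.v *)
(* A computation of the augmented transducer is a computation of T_R together *)
(* with a bit that depends only on the last letters of the two words: it is   *)
(* set iff these letters carry (q, l) and (q', _) with q' a successor of q    *)
(* under l and l the set of properties of the first word. Hence the last      *)
(* letters along an execution spell out a run of the Buchi automaton on the   *)
(* trace of the projected execution, and any such run can be written there.   *)

Require Import Defs.
From HB Require Import structures.
From mathcomp Require Import all_boot.

Set Implicit Arguments.
Unset Strict Implicit.
Unset Printing Implicit Defensive.

(** [aug_transducer_relE] splits a step of the augmented system into a step of [M] on the
    projections and [marks_step] on the last letters. For (a), [marks_step] forces the guessed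
    property set to be the true one, so the last marks form a run of [Angsp] on the trace, and
    accepting words are its visits to final states. For (b), the states of a run on the trace,
    paired with the true property sets, are written on the last letters. *)

Definition last_marks (Sigma : finType) (k : nat) (N : automaton {set 'I_k})
    (wa : seq (aug_alphabet Sigma N)) : option (state N) * option {set 'I_k} :=
  last (None, None) [seq (x.1.2, x.2) | x <- wa].

Definition marks_step (k : nat) (N : automaton {set 'I_k})
    (m1 m2 : option (state N) * option {set 'I_k}) (la : {set 'I_k}) : bool :=
  match m1, m2 with
  | (Some al1, Some la1), (Some al2, Some _) =>
      (al2 \in delta al1 la1) && (la == la1)
  | _, _ => false
  end.

Section AugmentedTransducer.

Variables (Sigma : finType) (M : regular_system Sigma) (k : nat).
Variables (Acop : 'I_k -> cdfa Sigma) (N : automaton {set 'I_k}).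

Implicit Types (wa ua va : seq (aug_alphabet Sigma N)) (w : seq Sigma).
Implicit Types (qc : {dffun forall i : 'I_k, cstate (Acop i)}).

Lemma aug_bitE (x y : aug_alphabet Sigma N) qc :
  aug_bit x y qc =
  marks_step (x.1.2, x.2) (y.1.2, y.2) [set i | qc i \in cfinal (Acop i)].
Proof.
case: x y => [[a1 [al1|]] [la1|]] [[a2 [al2|]] [la2|]] //=; congr (_ && _).
apply/forallP/eqP => [qcP | <- i]; last by rewrite inE.
by apply/setP => i; rewrite inE; apply/eqP.
Qed.

(** Only the [T_R]-component offers a choice: the cop-components and the bit are determined. Every
    letter overwrites the bit, so [b] survives only on empty words. *)
Lemma accepts_from_aug ua va (qR : state (rs_trans M)) qc b :
  size ua = size va ->
  accepts_from (N := aug_transducer M Acop N) (qR, qc, b) (zip ua va) =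
  accepts_from qR (zip (proj_Sigma ua) (proj_Sigma va)) &&
  (if ua is [::] then b else
   marks_step (last_marks ua) (last_marks va)
     [set i | foldl (@cdelta _ (Acop i)) (qc i) (proj_Sigma ua)
                \in cfinal (Acop i)]).
Proof.
elim: ua va qR qc b => [|x ua IH] [|y va] // qR qc b => [_|[eq_sz]].
  by rewrite /= inE.
pose qc1 : {dffun forall i, cstate (Acop i)} :=
  [ffun i => cdelta (qc i) x.1.1].
have qc1E i : qc1 i = cdelta (qc i) x.1.1 by rewrite ffunE.
transitivity [exists qR' in delta qR (x.1.1, y.1.1),
    accepts_from (N := aug_transducer M Acop N)
      (qR', qc1, aug_bit x y qc1) (zip ua va)].
  apply/exists_inP/exists_inP => [[[[qR' qc'] b']] | [qR' qR'P acc]].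
    rewrite inE => /and3P[qR'P /forallP qc'P /eqP->] acc; exists qR' => //.
    suff <- : qc' = qc1 by [].
    by apply/ffunP => i; rewrite qc1E; apply/eqP.
  exists (qR', qc1, aug_bit x y qc1) => //.
  rewrite inE qR'P eqxx andbT /=.
  by apply/forallP => i; rewrite qc1E.
rewrite [X in _ = _ && X]/=; set B := marks_step _ _ _.
have accE qR' : accepts_from (N := aug_transducer M Acop N)
      (qR', qc1, aug_bit x y qc1) (zip ua va) =
    accepts_from qR' (zip (proj_Sigma ua) (proj_Sigma va)) && B.
  rewrite IH //; congr (_ && _); rewrite {}/B /=.
  (* With an empty tail the bit just computed decides; otherwise a later letter overwrites it. *)
  case: ua va eq_sz {IH} => [|x' ua] [|y' va] //= _; first rewrite aug_bitE;
    by congr marks_step; apply/setP => i; rewrite !inE qc1E.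
apply/exists_inP/andP => [[qR' qR'P] | [/exists_inP[qR' qR'P acc] BP]].
  by rewrite accE => /andP[acc BP]; split=> //; apply/exists_inP; exists qR'.
by exists qR' => //; rewrite accE; apply/andP.
Qed.

Lemma aug_transducer_relE ua va :
  transducer_rel (aug_transducer M Acop N) ua va =
  transducer_rel (rs_trans M) (proj_Sigma ua) (proj_Sigma va) &&
  marks_step (last_marks ua) (last_marks va)
    [set i | caccepts (Acop i) (proj_Sigma ua)].
Proof.
rewrite /transducer_rel !size_map; case: eqP => //= eq_sz.
(* On empty words the initial bit is [false], matching the default marks [(None, None)], on which
   [marks_step] fails. *)
rewrite /accepts accepts_from_aug //; congr (_ && _); case: ua {eq_sz} => //= x ua.
by congr marks_step; apply/setP => i; rewrite !inE ffunE.
Qed.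

Lemma proj_aug_word w a (al : state N) la :
  proj_Sigma (aug_word w a al la) = rcons w a.
Proof. by rewrite /proj_Sigma map_rcons -map_comp map_id. Qed.

Lemma last_marks_aug_word w a (al : state N) la :
  last_marks (aug_word w a al la) = (Some al, Some la).
Proof. by rewrite /last_marks map_rcons last_rcons. Qed.

End AugmentedTransducer.

Theorem theorem18 (Sigma : finType) (M : regular_system Sigma)
  (k : nat) (cop : 'I_k -> pred (seq Sigma)) (Acop : 'I_k -> cdfa Sigma)
  (hcop : forall (i : 'I_k) (w : seq Sigma), caccepts (Acop i) w = cop i w)
  (gsp : (nat -> {set 'I_k}) -> Prop)
  (hgsp : exists B : automaton {set 'I_k},
      forall x : nat -> {set 'I_k}, buchi_accepts B x <-> gsp x)
  (Angsp : automaton {set 'I_k})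
  (hcomplete : complete Angsp)
  (hngsp : forall x : nat -> {set 'I_k}, buchi_accepts Angsp x <-> ~ gsp x) :
  (forall pia : nat -> seq (aug_alphabet Sigma Angsp),
      aug_accepting_execution M Acop pia ->
      execution M (fun i => proj_Sigma (pia i)) /\
      ~ satisfies cop gsp (fun i => proj_Sigma (pia i))) /\
  (forall pi : nat -> seq Sigma,
      execution M pi ->
      (* the construction marks the last letter, so states are nonempty words *)
      pi 0 <> [::] ->
      ~ satisfies cop gsp pi ->
      exists pia : nat -> seq (aug_alphabet Sigma Angsp),
        aug_accepting_execution M Acop pia /\
        forall i, proj_Sigma (pia i) = pi i).
Proof.
have cop_ofE w : [set i | caccepts (Acop i) w] = cop_of cop w.
  by apply/setP => i; rewrite !inE hcop.
split=> [pia [[init_pia step_pia] acc_pia] | pi [init_pi step_pi] pi0 nsat].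
  have {}step_pia i :
      transducer_rel (rs_trans M) (proj_Sigma (pia i)) (proj_Sigma (pia i.+1)) &&
      marks_step (last_marks (pia i)) (last_marks (pia i.+1))
        (cop_of cop (proj_Sigma (pia i))).
    by rewrite -cop_ofE -aug_transducer_relE.
  split.
    split=> [|i]; last by case/andP: (step_pia i).
    by have [w [a [la [acc_w ->]]]] := init_pia; rewrite proj_aug_word.
  (* The default only makes the run total: [marks_step] excludes [None] at every index. *)
  apply/hngsp; exists (fun i => odflt (start Angsp) (last_marks (pia i)).1).
  split=> [|i|n].
  - have [w [a [la [_ ->]]]] := init_pia.
    by rewrite last_marks_aug_word.
  - case/andP: (step_pia i) => _.
    case: (last_marks (pia i)) => [[al1|] [la1|]] //.
    by case: (last_marks _) => [[al2|] [la2|]] //= /andP[al2P /eqP->].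
  - have [m le_nm [w [a [al [la [al_fin pia_m]]]]]] := acc_pia n.
    by exists m; rewrite // pia_m last_marks_aug_word.
have [rho [rho0 rho_step rho_fin]] := (hngsp _).2 nsat.
(* The transducer relation preserves length, so nonemptiness propagates from [pi 0], and each word
   has a last letter to mark. *)
have pi_neq0 i : pi i <> [::].
  elim: i => // i IHi pi_i1; have /andP[/eqP eq_sz _] := step_pi i.
  by apply: IHi; apply: size0nil; rewrite eq_sz pi_i1.
pose pia i := if pi i is x :: s
  then aug_word (belast x s) (last x s) (rho i) (cop_of cop (pi i)) else [::].
have piaP i : exists w a,
    pi i = rcons w a /\ pia i = aug_word w a (rho i) (cop_of cop (pi i)).
  rewrite /pia; case: (pi i) (@pi_neq0 i) => // x s _.
  by exists (belast x s), (last x s); rewrite -lastI.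
have proj_pia i : proj_Sigma (pia i) = pi i.
  by have [w [a [-> ->]]] := piaP i; rewrite proj_aug_word.
have marks_pia i : last_marks (pia i) = (Some (rho i), Some (cop_of cop (pi i))).
  by have [w [a [_ ->]]] := piaP i; rewrite last_marks_aug_word.
exists pia; split=> //; split; first split.
- have [w [a [pi0E ->]]] := piaP 0; exists w, a, (cop_of cop (pi 0)).
  by rewrite -pi0E rho0.
- move=> i; rewrite aug_transducer_relE !proj_pia step_pi cop_ofE !marks_pia /=.
  by rewrite rho_step eqxx.
- move=> n; have [m le_nm rho_m] := rho_fin n; exists m => //.
  by have [w [a [_ ->]]] := piaP m; exists w, a, (rho m), (cop_of cop (pi m)).
Qed.
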